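(* Let $\mathbf{C}\in\mathbb{S}^d_+$ be full rank, let $1\le s\le d-1$, and suppose $\mathcal{X}=\{\mathbf{x}\in[0,1]^d:\ \mathbf{1}^\top\mathbf{x}=s\}$. Then the integrality gap of the ordinary-scaled linx relaxation satisfies $$\mathrm{Opt}_{\text{linx-o}}\ \ge\ \mathrm{Opt}-\tfrac12\big[s\log s+(d-s)\log(d-s)-d\log d\big]-\log\binom{d}{s}.$$
   Context: $\mathbb{S}^d_+$ is the cone of real symmetric positive semidefinite $d\times d$ matrices; $\mathbf{C}_{S,S}$ is the principal submatrix of $\mathbf{C}$ indexed by $S\subseteq\{1,\dots,d\}$; $\mathrm{Diag}(\mathbf{x})$ is the diagonal matrix with diagonal $\mathbf{x}$. $$\mathrm{Opt}=\min_{S\subseteq\{1,\dots,d\},\ |S|=s}\{-\log\det(\mathbf{C}_{S,S})\},$$ $$\mathrm{Opt}_{\text{linx-o}}=\min_{\mathbf{x}\in\mathcal{X}}\ \max_{\gamma_0>0}\Big\{-\tfrac12\log\det\big(\gamma_0\,\mathbf{C}\,\mathrm{Diag}(\mathbf{x})\,\mathbf{C}+\mathbf{I}_d-\mathrm{Diag}(\mathbf{x})\big)+\tfrac12 s\log\gamma_0\Big\},$$ with min/max understood as inf/sup. *)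

(* Defs.v *)
From HB Require Import structures.
From mathcomp Require Import all_boot all_order all_algebra.
From mathcomp Require Import all_classical all_reals all_analysis.

Set Implicit Arguments.
Unset Strict Implicit.
Unset Printing Implicit Defensive.

Import Order.TTheory GRing.Theory Num.Theory.

Local Open Scope classical_set_scope.
Local Open Scope ring_scope.

Definition psdmx (R : realType) (d : nat) (C : 'M[R]_d) : Prop :=
  C^T = C /\ forall v : 'cV[R]_d, 0 <= (v^T *m C *m v) ord0 ord0.

(* Rows and columns are listed in the order of [enum S]. *)
Definition principal_submx (R : realType) (d : nat) (C : 'M[R]_d)
    (S : {set 'I_d}) : 'M[R]_#|S| :=
  mxsub (@enum_val _ (mem S)) (@enum_val _ (mem S)) C.

(* Extended-valued, so that log det A = -oo when A is positive semidefinite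
   and singular. *)
Definition logdet (R : realType) (n : nat) (A : 'M[R]_n) : \bar R :=
  lne (\det A)%:E.

Definition Opt (R : realType) (d : nat) (C : 'M[R]_d) (s : nat) : \bar R :=
  ereal_inf [set (- logdet (principal_submx C S))%E
            | S in [set S : {set 'I_d} | #|S| = s]].

Definition linx_mx (R : realType) (d : nat) (C : 'M[R]_d) (g : R)
    (x : 'rV[R]_d) : 'M[R]_d :=
  g *: (C *m diag_mx x *m C) + 1%:M - diag_mx x.

Definition linx_obj (R : realType) (d : nat) (C : 'M[R]_d) (s : nat) (g : R)
    (x : 'rV[R]_d) : \bar R :=
  (- (2^-1)%:E * logdet (linx_mx C g x) + (2^-1 * s%:R * ln g)%:E)%E.

Definition Opt_linx_o (R : realType) (d : nat) (C : 'M[R]_d) (s : nat)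
    (X : set 'rV[R]_d) : \bar R :=
  ereal_inf [set ereal_sup [set linx_obj C s g x | g in [set g : R | 0 < g]]
            | x in X].

Definition cardinality_polytope (R : realType) (d s : nat) :
    set 'rV[R]_d :=
  [set x : 'rV[R]_d | (forall i, 0 <= x ord0 i <= 1) /\
                      \sum_(i < d) x ord0 i = s%:R].
Arguments cardinality_polytope R d s : clear implicits.

(* Main.v *)
Require Import Defs.
From mathcomp Require Import all_boot all_order all_algebra.
From mathcomp Require Import all_classical all_reals all_analysis.
From mathcomp Require Import perm complex zify ring lra.
Import Order.TTheory GRing.Theory Num.Theory.
Import numFieldNormedType.Exports.
Local Open Scope classical_set_scope.
Local Open Scope ring_scope.

Set Implicit Arguments.
Unset Strict Implicit.
Unset Printing Implicit Defensive.

(** Write [M] for the largest principal minor of order [s] of [C], so that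
    Opt = - log M, and, for [x] in the polytope, [D = Diag x].  It is enough
    to find, for each [x], a scaling [g > 0] (up to an arbitrarily small
    error) with
      det (g C D C + 1 - D) <= g^s M^2 e_s(x) e_(d-s)(1 - x),
    where e_k is the k-th elementary symmetric polynomial.  Indeed Maclaurin's
    inequality ([esym_le_mean]) bounds e_s(x) by binom(d,s) (s/d)^s and
    e_(d-s)(1 - x) by binom(d,s) ((d-s)/d)^(d-s), and minus one half of the
    logarithm of the resulting bound is exactly the claimed right-hand side.

    Suppose first 0 < x_i < 1 for all i ([linx_det_le_interior]).  With
    A = (1 - D)^(-1/2) and N = A C D C A, with eigenvalues l_i = c_i^2, the
    determinant is prod (1 - x_i) * prod (1 + g c_i^2), and two facts combine.

    - Choice of the scaling ([exists_scale_prod_le]): some g = h^2 satisfies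
      prod (1 + h^2 c_i^2) <= (h^s e_s(c))^2.  The right h is the one for which
      the angles atan (h c_i) add up to s pi/2.  After taking square
      roots and dividing, the inequality says that the sum over the sets S of
      size s of the products of the sines of the angles in S and the cosines
      of the others is at least 1, and this is proved by merging two angles
      at a time ([trig_prod_coef_ge1]).

    - A trace-norm type bound ([esym_sqrt_spectrum_le]): for every positive
      definite G, e_s(c)^2 <= E_s(G) E_s(G^-1 N), where E_s denotes the sum of
      the principal minors of order [s].  It comes from
      det G_SS det (G^-1)_SS >= 1 and the Cauchy-Schwarz inequality.  For
      G = A C A the factors are E_s(A C A) <= M e_s(1 / (1 - x)) and
      E_s(G^-1 N) = E_s(D C) <= M e_s(x).

    Finally [linx_det_le] reaches the boundary of the polytope by moving [x]
    slightly towards the barycentre (s/d, ..., s/d): the matrix is affine in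
    [x], and the determinant is monotone on positive semidefinite matrices. *)

(** * Spectral theorem for real symmetric matrices *)

(** Over the algebraic closure R[i] the spectral theorem for Hermitian matrices
    provides a real eigenvalue; being a root of the characteristic polynomial
    of [A], it is an eigenvalue over [R] as well. *)
Lemma sym_eigenvalue (R : rcfType) n (A : 'M[R]_n.+1) :
  A^T = A -> exists a, eigenvalue A a.
Proof.
move=> A_sym; pose f := real_complex R; pose B : 'M[R[i]]_n.+1 := map_mx f A.
have B_herm : B \is hermsymmx.
  apply: realsym_hermsym.
    apply/is_hermitianmxP; rewrite expr0 scale1r; apply/matrixP => i j.
    by rewrite !mxE -[in LHS]A_sym mxE.
  by apply/mxOverP => i j; rewrite mxE; apply/complex_realP; exists (A i j).
have /mxOverP/(_ 0 0)/complex_realP[a a_diag] := hermitian_spectral_diag_real B_herm.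
exists a; rewrite eigenvalue_root_char -(fmorph_root f) map_char_poly.
rewrite -eigenvalue_root_char.
have /hermitian_normalmx/orthomx_spectralP B_eq := B_herm.
apply/eigenvalueP; exists (row 0 (spectralmx B)).
  have PB : spectralmx B *m B = diag_mx (spectral_diag B) *m spectralmx B.
    by rewrite [X in _ *m X]B_eq !mulmxA mulmxV ?spectral_unit // mul1mx.
  by rewrite -row_mul PB row_mul row_diag_mx a_diag -scalemxAl -rowE.
apply/negP => /eqP row0.
have := spectral_unit B; rewrite -row_free_unit => /row_freeP[P].
move=> /(congr1 (row 0)); rewrite row_mul row0 mul0mx => /matrixP/(_ 0 0).
by rewrite !mxE /= => /eqP; rewrite eq_sym oner_eq0.
Qed.

Lemma rv_normsq_ge0 (R : realDomainType) n (v : 'rV[R]_n) : 0 <= (v *m v^T) 0 0.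
Proof. by rewrite mxE sumr_ge0 // => i _; rewrite mxE -expr2 sqr_ge0. Qed.

Lemma rv_normsq_eq0 (R : realDomainType) n (v : 'rV[R]_n) :
  ((v *m v^T) 0 0 == 0) = (v == 0).
Proof.
apply/eqP/eqP => [|->]; last by rewrite mul0mx mxE.
rewrite mxE => /eqP; rewrite psumr_eq0 => [/allP v0|i _].
  apply/rowP => i; have := v0 i (mem_index_enum i).
  by rewrite !mxE -expr2 sqrf_eq0 => /eqP.
by rewrite mxE -expr2 sqr_ge0.
Qed.

(** Completes a unit row to an orthogonal matrix: the Householder reflection
    along [v - e], where [e] is the first basis row, exchanges [e] and [v]. *)
Lemma unit_row_reflection (R : realFieldType) n (v : 'rV[R]_n.+1) :
  v *m v^T = 1%:M ->
  exists2 H : 'M[R]_n.+1, H *m H^T = 1%:M & row 0 H = v.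
Proof.
move=> v1; pose e : 'rV[R]_n.+1 := delta_mx 0 0; pose w := v - e.
have e1 : e *m e^T = 1%:M.
  by rewrite trmx_delta mul_delta_mx; apply/matrixP => i j; rewrite !mxE !ord1.
have [w0|w_neq0] := eqVneq w 0.
  exists 1%:M; first by rewrite trmx1 mulmx1.
  by rewrite row1; apply/esym/eqP; rewrite -subr_eq0; apply/eqP.
have q_neq0 : (w *m w^T) 0 0 != 0 by rewrite rv_normsq_eq0.
have wwq : w *m w^T = ((w *m w^T) 0 0)%:M by rewrite [LHS]mx11_scalar.
(* v and e are unit vectors, so e (v - e)^T = - |v - e|^2 / 2. *)
have evq : e *m w^T = (- ((w *m w^T) 0 0) / 2)%:M.
  have vee : v *m e^T = e *m v^T.
    rewrite -[LHS]trmxK trmx_mul trmxK.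
    by rewrite [LHS]mx11_scalar [RHS]mx11_scalar mxE.
  have -> : e *m w^T = - 2^-1 *: (w *m w^T).
    rewrite /w linearB /= mulmxBl !mulmxBr v1 e1 vee opprB !scalerDr.
    apply/matrixP => i j; rewrite !mxE.
    by field.
  by rewrite {1}wwq scale_scalar_mx mulNr mulrC mulNr.
move: q_neq0 wwq evq; set q := (w *m w^T) 0 0 => q_neq0 wwq evq.
exists (1%:M - (2 / q) *: (w^T *m w)).
  have -> : (1%:M - (2 / q) *: (w^T *m w))^T = 1%:M - (2 / q) *: (w^T *m w).
    by rewrite raddfB /= trmx1 linearZ /= trmx_mul trmxK.
  have PP : w^T *m w *m (w^T *m w) = q *: (w^T *m w).
    by rewrite mulmxA -[w^T *m w *m _]mulmxA wwq mul_mx_scalar -scalemxAl.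
  move: (w^T *m w) PP => P PP.
  rewrite mulmxBl !mulmxBr !mul1mx mulmx1 -scalemxAl -scalemxAr PP.
  apply/matrixP => i j; rewrite !mxE.
  by field.
rewrite rowE mulmxBr mulmx1 -/e -scalemxAr mulmxA evq mul_scalar_mx scalerA.
rewrite (_ : 2 / q * _ = -1); last by field.
by rewrite scaleN1r opprK addrC subrK.
Qed.

(** Conjugating by an orthogonal matrix whose first row is a unit eigenvector
    splits off a 1 x 1 block; the symmetry of [A] clears both off-diagonal
    blocks, and the remaining block is handled by induction. *)
Lemma sym_spectral (R : rcfType) n (A : 'M[R]_n) : A^T = A ->
  exists V (l : 'rV[R]_n), V *m V^T = 1%:M /\ V *m A *m V^T = diag_mx l.
Proof.
elim: n A => [|n IHn] A A_sym.
  by exists 1%:M, 0; split; rewrite [LHS]flatmx0 [RHS]flatmx0.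
have [a /eigenvalueP[u uA u_neq0]] := sym_eigenvalue A_sym.
have uu_gt0 : 0 < (u *m u^T) 0 0 by rewrite lt0r rv_normsq_eq0 u_neq0 rv_normsq_ge0.
set q := (u *m u^T) 0 0 in uu_gt0.
pose v := (Num.sqrt q)^-1 *: u.
have vA : v *m A = a *: v by rewrite -scalemxAl uA !scalerA mulrC.
have v1 : v *m v^T = 1%:M.
  rewrite linearZ /= -scalemxAl -scalemxAr scalerA [u *m u^T]mx11_scalar -/q.
  rewrite scale_scalar_mx -invfM -expr2 sqr_sqrtr ?ltW // mulVf //.
  by rewrite gt_eqF.
have [H HH Hv] := unit_row_reflection v1.
have [B B_def] : exists B : 'M[R]_(1 + n), B = H *m A *m H^T by eexists.
have B_sym : B^T = B by rewrite B_def !trmx_mul trmxK A_sym mulmxA.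
have B0 (i j : 'I_(1 + n)) : val i = 0%N -> B i j = a *+ (val j == 0%N).
  move=> /= i0; have -> : i = 0 by exact: val_inj.
  have /rowP/(_ j) : row 0 B = a *: delta_mx 0 0.
    by rewrite B_def !row_mul Hv vA -scalemxAl -Hv -row_mul HH row1.
  by rewrite mxE => ->; rewrite !mxE mulr_natr.
have B_eq : B = block_mx a%:M 0 0 (drsubmx B).
  rewrite -[LHS]submxK; congr block_mx; apply/matrixP => i j.
  - by rewrite !mxE B0 //= !ord1.
  - by rewrite !mxE B0 //= ord1.
  - by rewrite -B_sym !mxE B0 //= ord1.
have [|V [l [VV VBV]]] := IHn (drsubmx B).
  by rewrite trmx_drsub B_sym.
pose W : 'M[R]_(1 + n) := block_mx 1%:M 0 0 V.
have WW : W *m W^T = 1%:M.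
  rewrite /W tr_block_mx mulmx_block !trmx0 trmx1 !mulmx0 !mul0mx mulmx1.
  by rewrite !addr0 !add0r VV -scalar_mx_block.
have WBW : W *m B *m W^T = diag_mx (row_mx a%:M l).
  rewrite /W tr_block_mx B_eq !mulmx_block !trmx0 trmx1 !mulmx0 !mul0mx.
  rewrite !addr0 !add0r !mul0mx !mulmx1 mul1mx VBV diag_mx_row; congr block_mx.
  by apply/matrixP => i j; rewrite !mxE !ord1 eqxx.
exists (W *m H), (row_mx a%:M l : 'rV[R]_(1 + n)); rewrite trmx_mul; split.
  by rewrite mulmxA -[_ *m H *m H^T]mulmxA HH mulmx1.
by rewrite -WBW B_def !mulmxA.
Qed.

(** * Positive semidefinite matrices *)

Lemma psdmxD (R : realType) n (A B : 'M[R]_n) :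
  psdmx A -> psdmx B -> psdmx (A + B).
Proof.
move=> [AT A0] [BT B0]; split=> [|v]; first by rewrite raddfD /= AT BT.
by rewrite mulmxDr mulmxDl mxE addr_ge0.
Qed.

Lemma psdmxZ (R : realType) n (a : R) (A : 'M[R]_n) :
  0 <= a -> psdmx A -> psdmx (a *: A).
Proof.
move=> a0 [AT A0]; split=> [|v]; first by rewrite linearZ /= AT.
by rewrite -scalemxAr -scalemxAl mxE mulr_ge0.
Qed.

Lemma psdmx_congr (R : realType) m n (B : 'M[R]_(m, n)) (A : 'M[R]_n) :
  psdmx A -> psdmx (B *m A *m B^T).
Proof.
move=> [AT A0]; split=> [|v]; first by rewrite !trmx_mul trmxK AT mulmxA.
by have := A0 (B^T *m v); rewrite trmx_mul trmxK !mulmxA.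
Qed.

Lemma psdmx_diag (R : realType) n (w : 'rV[R]_n) :
  (forall i, 0 <= w 0 i) -> psdmx (diag_mx w).
Proof.
move=> w0; split=> [|v]; first by rewrite tr_diag_mx.
rewrite mxE sumr_ge0 // => i _; rewrite mul_mx_diag !mxE mulrAC mulr_ge0 //.
by rewrite -expr2 sqr_ge0.
Qed.

Lemma psdmx_spectral (R : realType) n (A : 'M[R]_n) : psdmx A ->
  exists V (l : 'rV[R]_n), [/\ V *m V^T = 1%:M, V *m A *m V^T = diag_mx l
                              & forall i, 0 <= l 0 i].
Proof.
move=> A_psd; have [V [l [VV VAV]]] := sym_spectral A_psd.1.
exists V, l; split=> // i; have [_ /(_ (delta_mx i 0))] := psdmx_congr V A_psd.
by rewrite VAV trmx_delta -rowE -colE !mxE eqxx.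
Qed.

Lemma psdmx_sqrt (R : realType) n (A : 'M[R]_n) : psdmx A ->
  exists L : 'M[R]_n, A = L *m L^T.
Proof.
move=> /psdmx_spectral[V [l [VV VAV l_ge0]]].
have VTV := mulmx1C VV.
exists (V^T *m diag_mx (map_mx Num.sqrt l)).
rewrite trmx_mul trmxK tr_diag_mx mulmxA -[_ *m diag_mx _ *m diag_mx _]mulmxA.
rewrite mulmx_diag (_ : \row_j _ = l); last first.
  by apply/rowP => i; rewrite !mxE -expr2 sqr_sqrtr.
by rewrite -VAV !mulmxA VTV mul1mx -mulmxA VTV mulmx1.
Qed.

Lemma psdmx_det_ge0 (R : realType) n (A : 'M[R]_n) : psdmx A -> 0 <= \det A.
Proof.
by move=> /psdmx_sqrt[L ->]; rewrite det_mulmx det_tr -expr2 sqr_ge0.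
Qed.

Lemma psdmx_det_gt0 (R : realType) n (A : 'M[R]_n) :
  psdmx A -> A \in unitmx -> 0 < \det A.
Proof. by move=> /psdmx_det_ge0 detA; rewrite unitmxE unitfE lt0r => ->. Qed.

Lemma orthomx_det1D (R : realType) n (V A : 'M[R]_n) (l : 'rV[R]_n) z :
  V *m V^T = 1%:M -> V *m A *m V^T = diag_mx l ->
  \det (1%:M + z *: A) = \prod_i (1 + z * l 0 i).
Proof.
move=> VV VAV; have : \det (V *m V^T) = 1 by rewrite VV det1.
rewrite det_mulmx => detV.
have <- : \det (V *m (1%:M + z *: A) *m V^T) = \det (1%:M + z *: A).
  by rewrite !det_mulmx mulrAC detV mul1r.
rewrite mulmxDr mulmxDl mulmx1 VV -scalemxAr -scalemxAl VAV.
rewrite -diag_const_mx -[diag_mx l]scale1r scalerA mulr1 -linearZ -linearD /= det_diag.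
by apply: eq_bigr => i _; rewrite !mxE.
Qed.

(** For invertible [A = L L^T], the quotient of the two determinants is
    det (1 + L^-1 B L^-T), a product of factors [1 + l_i] with [l_i >= 0]. *)
Lemma psdmx_det_le (R : realType) n (A B : 'M[R]_n) :
  psdmx A -> psdmx B -> \det A <= \det (A + B).
Proof.
move=> A_psd B_psd; have AB_ge0 := psdmx_det_ge0 (psdmxD A_psd B_psd).
have [A_unit|] := boolP (A \in unitmx); last first.
  by rewrite unitmxE unitfE negbK => /eqP ->.
have [L A_eq] := psdmx_sqrt A_psd.
have L_unit : L \in unitmx.
  by move: A_unit; rewrite A_eq unitmx_mul => /andP[].
pose N := invmx L *m B *m (invmx L)^T.
have -> : A + B = L *m (1%:M + 1 *: N) *m L^T.
  rewrite scale1r mulmxDr mulmxDl mulmx1 -A_eq /N !mulmxA mulmxV // mul1mx.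
  by rewrite -mulmxA -trmx_mul mulmxV // trmx1 mulmx1.
have [V [l [VV VNV l_ge0]]] := psdmx_spectral (psdmx_congr (invmx L) B_psd).
rewrite !det_mulmx mulrAC -det_mulmx -A_eq ler_peMr ?psdmx_det_ge0 //.
rewrite (orthomx_det1D _ VV VNV) //.
elim/big_ind: _ => // [x y|i _]; first exact: mulr_ege1.
by rewrite mul1r lerDl.
Qed.

Lemma psdmx_compress_unit (R : realType) m n (J : 'M[R]_(m, n)) (A : 'M[R]_n) :
  psdmx A -> A \in unitmx -> J *m J^T = 1%:M -> J *m A *m J^T \in unitmx.
Proof.
move=> /psdmx_sqrt[L ->]; rewrite unitmx_mul => /andP[L_unit _] JJ.
rewrite -row_free_unit; apply: inj_row_free => v.
move=> /(congr1 (mulmx^~ v^T)); rewrite mul0mx => v0.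
have : v *m J *m L == 0.
  rewrite -rv_normsq_eq0 !trmx_mul !mulmxA; move: v0; rewrite !mulmxA => ->.
  by rewrite mxE.
move=> /eqP/(congr1 (mulmx^~ (invmx L *m J^T))).
by rewrite mul0mx !mulmxA mulmxK // -mulmxA JJ mulmx1.
Qed.

(** The compression of an inverse dominates the inverse of the compression:
    with [a] the compression of [G] and [N = J G^-1 - a^-1 J], one has
    J G^-1 J^T = a^-1 + N G N^T.  For [J] a coordinate projection, this is
    Fischer's inequality combined with Jacobi's formula for the minors of the
    inverse. *)
Lemma psdmx_det_compress_inv (R : realType) m n (J : 'M[R]_(m, n)) (G : 'M[R]_n) :
  psdmx G -> G \in unitmx -> J *m J^T = 1%:M ->
  1 <= \det (J *m G *m J^T) * \det (J *m invmx G *m J^T).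
Proof.
move=> G_psd G_unit JJ; set a := J *m G *m J^T; set b := J *m invmx G *m J^T.
have a_unit : a \in unitmx by exact: psdmx_compress_unit.
have a_psd : psdmx a by exact: psdmx_congr.
have a_sym := a_psd.1; have G_sym := G_psd.1.
have tr_inv k (M : 'M[R]_k) : M^T = M -> (invmx M)^T = invmx M.
  by move=> MT; rewrite trmx_inv MT.
pose N := J *m invmx G - invmx a *m J.
have N_G : N *m G = J - invmx a *m J *m G by rewrite mulmxBl mulmxKV.
have N_tr : N^T = invmx G *m J^T - J^T *m invmx a.
  by rewrite raddfB /= !trmx_mul !tr_inv.
have b_eq : b = invmx a + N *m G *m N^T.
  rewrite N_G N_tr mulmxBr (mulmxBl _ _ (J^T *m invmx a)).
  rewrite (mulmxBl _ _ (invmx G *m J^T)).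
  rewrite !mulmxA mulmxK // JJ mul1mx -[invmx a *m J *m J^T]mulmxA JJ mulmx1.
  rewrite -[invmx a *m J *m G]mulmxA -[invmx a *m (J *m G) *m J^T]mulmxA mulVmx //.
  by rewrite mul1mx subrr subr0 addrC subrK.
have inv_psd : psdmx (invmx a).
  by have := psdmx_congr (invmx a) a_psd; rewrite mulVmx // mul1mx tr_inv.
have := psdmx_det_le inv_psd (psdmx_congr N G_psd); rewrite -b_eq det_inv => det_b.
apply: le_trans (ler_wpM2l (psdmx_det_ge0 a_psd) det_b).
by rewrite divff // gt_eqF // psdmx_det_gt0.
Qed.

(** * Sums of principal minors *)

Definition pminor (R : comNzRingType) n (A : 'M[R]_n) (S : {set 'I_n}) : R :=
  \det (mxsub (@enum_val _ (mem S)) (@enum_val _ (mem S)) A).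

(** The [k]-th elementary symmetric polynomial of the eigenvalues of [A]. *)
Definition sum_pminors (R : comNzRingType) n (k : nat) (A : 'M[R]_n) : R :=
  \sum_(S : {set 'I_n} | #|S| == k) pminor A S.

Lemma det_mxsub_bij (R : comNzRingType) m n (f : 'I_m -> 'I_n) (A : 'M[R]_n) :
  bijective f -> \det (mxsub f f A) = \det A.
Proof.
move=> f_bij; have mn : m = n by have := bij_eq_card f_bij; rewrite !card_ord.
case: _ / mn A f f_bij => A f /bij_inj f_inj.
have -> : mxsub f f A = row_perm (perm f_inj) (col_perm (perm f_inj) A).
  by apply/matrixP => i j; rewrite !mxE !permE.
rewrite row_permE col_permE !det_mulmx mulrCA !det_perm odd_permV.
by rewrite -signr_addb addbb mulr1.
Qed.

(** Listing the indices of [S] first makes the matrix block triangular, with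
    an identity block on the complement of [S]. *)
Lemma det_identity_rows (R : comNzRingType) n (A : 'M[R]_n) (S : {set 'I_n}) :
  \det (\matrix_(i, j) if i \in S then A i j else (i == j)%:R) = pminor A S.
Proof.
pose f (k : 'I_(#|S| + #|~: S|)) : 'I_n :=
  match fintype.split k with inl a => enum_val a | inr b => enum_val b end.
have f_inj : injective f.
  move=> k l; rewrite /f; case: splitP => a ka; case: splitP => b lb ab.
  - by apply: val_inj; rewrite /= ka lb (enum_val_inj ab).
  - by have := enum_valP b; rewrite -ab inE enum_valP.
  - by have := enum_valP a; rewrite ab inE enum_valP.
  - by apply: val_inj; rewrite /= ka lb (enum_val_inj ab).
have f_bij : bijective f.
  by apply: inj_card_bij => //; rewrite !card_ord cardsC card_ord.
rewrite -(det_mxsub_bij _ f_bij) -[mxsub f f _]submxK.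
have fl a : f (lshift _ a) = enum_val a by rewrite /f (unsplitK (inl a)).
have fr b : f (rshift _ b) = enum_val b by rewrite /f (unsplitK (inr b)).
have frS b : f (rshift _ b) \in S = false.
  by apply/negbTE; rewrite fr; have := enum_valP b; rewrite inE.
rewrite (_ : dlsubmx _ = 0) ?det_ublock; last first.
  apply/matrixP => i j; rewrite !mxE frS (inj_eq f_inj).
  by rewrite eq_rlshift.
rewrite (_ : drsubmx _ = 1%:M) ?det1 ?mulr1; last first.
  by apply/matrixP => i j; rewrite !mxE frS (inj_eq f_inj) eq_rshift.
by congr (\det _); apply/matrixP => i j; rewrite !mxE !fl enum_valP.
Qed.

(** Expanding every factor [1 (i = s i) + A i (s i)] of the Leibniz formula
    gives, for each set [S] of rows where [A] is chosen, the determinant of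
    [A] with the other rows replaced by those of the identity. *)
Lemma det1D_pminors (R : comNzRingType) n (A : 'M[R]_n) :
  \det (1%:M + A) = \sum_(S : {set 'I_n}) pminor A S.
Proof.
under eq_bigr do rewrite -det_identity_rows.
rewrite exchange_big /=; apply: eq_bigr => s _.
rewrite -mulr_sumr; congr (_ * _).
under eq_bigr do rewrite !mxE addrC.
rewrite bigA_distr; apply: eq_bigr => S _; apply: eq_bigr => i _.
by rewrite mxE.
Qed.

Lemma coef_det1DX (R : comNzRingType) n k (A : 'M[R]_n) :
  (\det (1%:M + 'X *: map_mx polyC A))`_k = sum_pminors k A.
Proof.
rewrite det1D_pminors coef_sum /sum_pminors [RHS]big_mkcond.
apply: eq_bigr => S _.
have -> : pminor ('X *: map_mx polyC A) S = (pminor A S)%:P * 'X^#|S|.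
  by rewrite /pminor linearZ /= detZ -map_mxsub det_map_mx mulrC.
by rewrite coefCM coefXn eq_sym; case: eqP => _; rewrite ?mulr1 ?mulr0.
Qed.

(** [sum_pminors k] is a coefficient of det (1 + X A), hence invariant under
    conjugation. *)
Lemma sum_pminorsC (R : comUnitRingType) n k (A B : 'M[R]_n) :
  A \in unitmx -> sum_pminors k (A *m B) = sum_pminors k (B *m A).
Proof.
move=> A_unit; rewrite -!coef_det1DX; congr (_ `_ k).
rewrite !map_mxM /=; set a := map_mx _ A; set b := map_mx _ B.
pose c := map_mx (@polyC R) (invmx A).
have ac : a *m c = 1%:M by rewrite -map_mxM mulmxV // map_mx1.
have -> : 1%:M + 'X *: (a *m b) = a *m (1%:M + 'X *: (b *m a)) *m c.
  rewrite mulmxDr mulmxDl mulmx1 ac -scalemxAr -scalemxAl !mulmxA.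
  by rewrite -[a *m b *m a *m c]mulmxA ac mulmx1.
by rewrite !det_mulmx mulrAC -det_mulmx ac det1 mul1r.
Qed.

Lemma pminor_tr (R : comNzRingType) n (A : 'M[R]_n) S :
  pminor A^T S = pminor A S.
Proof.
rewrite /pminor -[LHS]det_tr; congr (\det _).
by apply/matrixP => i j; rewrite !mxE.
Qed.

Lemma pminor_diagM (R : comNzRingType) n (w : 'rV[R]_n) (A : 'M[R]_n) S :
  pminor (diag_mx w *m A) S = \prod_(i in S) w 0 i * pminor A S.
Proof.
rewrite /pminor; set A_S := mxsub _ _ A.
rewrite (_ : mxsub _ _ _ = diag_mx (\row_j w 0 (enum_val j)) *m A_S).
  rewrite det_mulmx det_diag; congr (_ * _).
  by under eq_bigr do rewrite mxE; rewrite -big_enum_val.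
by rewrite /A_S !mul_diag_mx; apply/matrixP => i j; rewrite !mxE.
Qed.

Lemma pminor_mul_diag (R : comNzRingType) n (w : 'rV[R]_n) (A : 'M[R]_n) S :
  pminor (A *m diag_mx w) S = pminor A S * \prod_(i in S) w 0 i.
Proof.
by rewrite -pminor_tr trmx_mul tr_diag_mx pminor_diagM pminor_tr mulrC.
Qed.

Lemma coef_prod_linear (R : comNzRingType) (I : finType) (c s : I -> R) k :
  (\prod_i ((c i)%:P + s i *: 'X))`_k =
  \sum_(S : {set I} | #|S| == k) \prod_i (if i \in S then s i else c i).
Proof.
under eq_bigr do rewrite addrC.
rewrite bigA_distr coef_sum [RHS]big_mkcond; apply: eq_bigr => S _.
rewrite (_ : \prod_i _ = (\prod_i (if i \in S then s i else c i)) *: 'X^#|S|).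
  by rewrite coefZ coefXn eq_sym; case: eqP => _; rewrite ?mulr1 ?mulr0.
rewrite -prodr_const [X in _ *: X]big_mkcond -scaler_prod; apply: eq_bigr => i _.
by case: ifP; rewrite // alg_polyC.
Qed.

(** * The choice of the scaling *)

Lemma coef_mul_ge0 (R : realFieldType) (p q : {poly R}) :
  (forall k, 0 <= p`_k) -> (forall k, 0 <= q`_k) -> forall k, 0 <= (p * q)`_k.
Proof. by move=> p0 q0 k; rewrite coefM sumr_ge0 // => i _; rewrite mulr_ge0. Qed.

Lemma coef_prod_linear_ge0 (R : realFieldType) (T : eqType) (r : seq T)
    (c s : T -> R) :
  {in r, forall t, 0 <= c t} -> {in r, forall t, 0 <= s t} ->
  forall k, 0 <= (\prod_(t <- r) ((c t)%:P + s t *: 'X))`_k.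
Proof.
move=> c0 s0; rewrite big_seq.
elim/big_ind: _ => [k|p q|t t_r k]; first by rewrite coef1 ler0n.
  exact: coef_mul_ge0.
rewrite coefD coefC coefZ coefX addr_ge0 ?mulr_ge0 ?ler0n ?s0 //.
by case: eqP => _; rewrite ?c0.
Qed.

(** Two angles [t1] and [t2] are merged without increasing the coefficient.
    If [t1 + t2 <= pi / 2], the factors
    (cos t1 + sin t1 X) (cos t2 + sin t2 X) exceed
    cos (t1 + t2) + sin (t1 + t2) X by sin t1 sin t2 (1 + X^2).  Otherwise they
    exceed X (cos u + sin u X), with [u = t1 + t2 - pi / 2], by
    cos t1 cos t2 (1 + X^2).  A single angle left is 0 or pi / 2, where the
    coefficient is 1. *)
Lemma trig_prod_coef_ge1 (R : realType) (ts : seq R) (s : nat) :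
  {in ts, forall t, 0 <= t <= pi / 2} ->
  \sum_(t <- ts) t = s%:R * (pi / 2) ->
  1 <= (\prod_(t <- ts) ((cos t)%:P + sin t *: 'X))`_s.
Proof.
have pi2_gt0 : 0 < pi / 2 :> R by rewrite divr_gt0 ?pi_gt0.
have [n] := ubnP (size ts); elim: n ts s => // n IHn [|t1 [|t2 ts]] s /= size_ts.
- move=> _; rewrite !big_nil => /esym/eqP; rewrite mulf_eq0 (gt_eqF pi2_gt0) orbF.
  by rewrite pnatr_eq0 => /eqP ->; rewrite coef1.
- move=> /(_ t1); rewrite mem_head => /(_ isT) /andP[t_ge0 t_le].
  rewrite !big_seq1 => t_eq; move: t_le.
  rewrite t_eq ger_pMl // -[leRHS]/(1%:R) ler_nat.
  case: s t_eq => [|[|//]] _ _; first by rewrite mul0r cos0 sin0 scale0r addr0 coefC.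
  by rewrite mul1r cos_pihalf sin_pihalf scale1r add0r coefX.
move=> ts_in sum_ts.
have t1_in : 0 <= t1 <= pi / 2 by rewrite ts_in ?mem_head.
have t2_in : 0 <= t2 <= pi / 2 by rewrite ts_in // !inE eqxx orbT.
have {}ts_in : {in ts, forall t, 0 <= t <= pi / 2}.
  by move=> t t_ts; rewrite ts_in // !inE t_ts !orbT.
have cos_ge0 (t : R) : 0 <= t <= pi / 2 -> 0 <= cos t.
  by move=> /andP[t_ge0 t_le]; rewrite cos_ge0_pihalf // t_le andbT; lra.
have sin_ge0 (t : R) : 0 <= t <= pi / 2 -> 0 <= sin t.
  by move=> /andP[t_ge0 t_le]; rewrite sin_ge0_pi // t_ge0; lra.
move: sum_ts; rewrite !big_cons addrA => sum_ts.
set P := \prod_(t <- ts) _.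
have P_ge0 k : 0 <= P`_k.
  by apply: coef_prod_linear_ge0 => t /ts_in; [exact: cos_ge0|exact: sin_ge0].
have XX_ge0 a k : 0 <= a -> 0 <= ((a *: (1 + 'X^2)) * P)`_k.
  move=> a0; apply: coef_mul_ge0 => // l.
  by rewrite coefZ coefD coef1 coefXn mulr_ge0 // addr_ge0 ?ler0n.
have [t12_le|t12_gt] := leP (t1 + t2) (pi / 2).
- have := IHn ((t1 + t2) :: ts) s size_ts.
  rewrite !big_cons -/P => IH; apply: le_trans (IH _ sum_ts) _.
    move=> t; rewrite inE => /orP[/eqP ->|/ts_in//].
    by rewrite t12_le andbT; lra.
  rewrite -subr_ge0 -coefB.
  rewrite (_ : _ - _ = (sin t1 * sin t2) *: (1 + 'X^2) * P).
    by rewrite XX_ge0 ?mulr_ge0 ?sin_ge0.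
  rewrite cosD sinD -!mul_polyC !rmorphB !rmorphD !rmorphM /=; ring.
(* Here t1 + t2 > pi / 2, which rules out s = 0. *)
case: s sum_ts => [|s] sum_ts.
  have : 0 <= \sum_(t <- ts) t by rewrite big_seq sumr_ge0 // => t /ts_in/andP[].
  by move: sum_ts t12_gt pi2_gt0; rewrite mul0r; lra.
have := IHn ((t1 + t2 - pi / 2) :: ts) s size_ts.
rewrite !big_cons -/P => IH; apply: le_trans (IH _ _) _.
- move=> t; rewrite inE => /orP[/eqP ->|/ts_in//].
  by apply/andP; split; lra.
- by move: sum_ts; rewrite -natr1 mulrDl mul1r; lra.
set Q := _ * P; have -> : Q`_s = ('X * Q)`_s.+1 by rewrite coefXM.
rewrite -subr_ge0 -coefB /Q.
rewrite (_ : _ - _ = (cos t1 * cos t2) *: (1 + 'X^2) * P).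
  by rewrite XX_ge0 ?mulr_ge0 ?cos_ge0.
rewrite cosB sinB cos_pihalf sin_pihalf !mulr0 !mulr1 add0r sub0r cosD sinD.
rewrite -!mul_polyC !rmorphN !rmorphB !rmorphD !rmorphM /=; ring.
Qed.

Lemma continuous_sum_atan (R : realType) (I : Type) (r : seq I) (c : I -> R) :
  continuous (fun h : R => \sum_(i <- r) atan (h * c i)).
Proof.
elim: r => [|i r IHr] h.
  rewrite (_ : (fun _ => _) = cst 0); first exact: cvg_cst.
  by apply/funext => x; rewrite big_nil.
rewrite (_ : (fun _ => _) =
    (fun x => atan (x * c i)) \+ (fun x : R => \sum_(i <- r) atan (x * c i))).
  apply: continuousD; last exact: IHr.
  apply: (@continuous_comp _ _ _ (fun x : R => x * c i) (@atan R)); last first.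
    exact: continuous_atan.
  by apply: cvgM; [exact: cvg_id|exact: cvg_cst].
by apply/funext => x; rewrite big_cons.
Qed.

(** The sum of the arctangents vanishes for [h = 0] and tends to
    [d * (pi / 2)]; the intermediate value theorem applies. *)
Lemma exists_sum_atan (R : realType) d (c : 'I_d -> R) (s : nat) :
  (forall i, 0 < c i) -> (0 < s < d)%N ->
  exists2 h : R, 0 < h & \sum_i atan (h * c i) = s%:R * (pi / 2).
Proof.
move=> c_gt0 /andP[s_gt0 s_lt].
have pi2_gt0 : 0 < pi / 2 :> R by rewrite divr_gt0 ?pi_gt0.
have d_gt0 : 0 < d%:R :> R by rewrite ltr0n (leq_trans _ s_lt).
pose f (h : R) := \sum_i atan (h * c i).
have f0 : f 0 = 0 by rewrite /f big1 // => i _; rewrite mul0r atan0.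
have v_gt0 : 0 < s%:R * (pi / 2) :> R by rewrite mulr_gt0 ?ltr0n.
pose t : R := s%:R / d%:R * (pi / 2).
have t_gt0 : 0 < t by rewrite mulr_gt0 // divr_gt0 // ltr0n.
have t_in : t \in `](- (pi / 2)), (pi / 2)[.
  rewrite in_itv /= (lt_trans _ t_gt0) ?oppr_lt0 //=.
  by rewrite gtr_pMl // ltr_pdivrMr // mul1r ltr_nat.
have tan_t_ge0 : 0 <= tan t.
  rewrite leNgt; apply/negP => /(@lt_atan R); rewrite tanK // atan0 ltNge => /negP[].
  exact: ltW.
(* Large enough for every atan (b * c i) to reach the average angle t. *)
pose b := \sum_i tan t / c i.
have b_ge0 : 0 <= b by rewrite sumr_ge0 // => i _; rewrite divr_ge0 // ltW.
have fb : s%:R * (pi / 2) <= f b.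
  have -> : s%:R * (pi / 2) = \sum_(i < d) t :> R.
    rewrite sumr_const card_ord -mulr_natl /t.
    by field; rewrite gt_eqF.
  apply: ler_sum => i _; rewrite -[leLHS](tanK t_in); apply: le_atan.
  rewrite -ler_pdivrMr // /b (bigD1 i) //= lerDl sumr_ge0 // => j _.
  by rewrite divr_ge0 // ltW.
have [||h /[!in_itv]/=/andP[h_ge0 _] fh] := @IVT R f 0 b (s%:R * (pi / 2)) b_ge0.
- by apply: continuous_subspaceT; exact: continuous_sum_atan.
- by rewrite f0 ge_min le_max fb (ltW v_gt0) orbT.
exists h => //; rewrite lt0r h_ge0 andbT; apply/eqP => h0.
by move: v_gt0; rewrite -fh h0 f0 ltxx.
Qed.

(** With the angles [th i = atan (h * c i)] adding up to [s * (pi / 2)], the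
    sum of the products of sines and cosines over the sets of size [s] is
    [h ^+ s] times the symmetric sum in the [c i], divided by the square root
    of the left-hand side. *)
Lemma exists_scale_prod_le (R : realType) d (c : 'I_d -> R) (s : nat) :
  (forall i, 0 < c i) -> (0 < s < d)%N ->
  exists2 h : R, 0 < h &
    \prod_i (1 + (h * c i) ^+ 2) <=
    (h ^+ s * \sum_(S : {set 'I_d} | #|S| == s) \prod_(i in S) c i) ^+ 2.
Proof.
move=> c_gt0 s_bounds; have [h h_gt0 sum_h] := exists_sum_atan c_gt0 s_bounds.
exists h => //; pose th i := atan (h * c i).
have hc_gt0 i : 0 < h * c i by rewrite mulr_gt0.
have := @trig_prod_coef_ge1 R [seq th i | i <- index_enum 'I_d] s.
rewrite !big_map sum_h coef_prod_linear => /(_ _ erefl) H.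
have {}H := H _; move: H.
have th_in : {in [seq th i | i <- index_enum 'I_d], forall t, 0 <= t <= pi / 2}.
  move=> _ /mapP[i _ ->]; rewrite (ltW (atan_ltpi2 _)) andbT.
  by rewrite -(@atan0 R) ltW // lt_atan.
move=> /(_ th_in); set E := \sum_(S | _) _ => E_ge1.
have cos_th i : cos (th i) = (Num.sqrt (1 + (h * c i) ^+ 2))^-1 by rewrite cos_atan.
have sq_gt0 i : 0 < 1 + (h * c i) ^+ 2 by rewrite ltr_pwDl ?sqr_ge0.
have cos_gt0 i : 0 < cos (th i) by rewrite cos_th invr_gt0 sqrtr_gt0.
have sin_th i : sin (th i) = h * c i * cos (th i).
  have -> : h * c i = tan (th i) by rewrite atanK.
  by rewrite /tan mulfVK // gt_eqF.
have prod_cos_gt0 : 0 < \prod_i cos (th i) by exact: prodr_gt0.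
have prod_eq : \prod_i (1 + (h * c i) ^+ 2) = ((\prod_i cos (th i))^-1) ^+ 2.
  rewrite -prodfV -prodrXl; apply: eq_bigr => i _.
  by rewrite cos_th invrK sqr_sqrtr // ltW.
rewrite prod_eq ler_pXn2r ?nnegrE ?invr_ge0 ?(ltW prod_cos_gt0) //; last first.
  rewrite mulr_ge0 ?exprn_ge0 ?(ltW h_gt0) // sumr_ge0 // => S _.
  by rewrite prodr_ge0 // => i _; rewrite ltW.
rewrite -[leLHS]mulr1 ler_pdivrMl //.
apply: le_trans E_ge1 _; rewrite le_eqVlt; apply/orP; left; apply/eqP.
rewrite !mulr_sumr; apply: eq_bigr => S /eqP <-.
transitivity (\prod_i (cos (th i) * (if i \in S then h * c i else 1))).
  by apply: eq_bigr => i _; case: ifP => _; rewrite ?mulr1 // sin_th mulrC.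
by rewrite big_split -big_mkcond big_split /= prodr_const.
Qed.

(** * Maclaurin's inequality *)

Lemma exists_opposite_side (R : realFieldType) (m x : R) (r : seq R) :
  r != [::] -> x + \sum_(y <- r) y = (size r).+1%:R * m ->
  exists2 b, b \in r & 0 <= (m - x) * (b - m).
Proof.
move=> r_neq0 sum_r.
have [/hasP[b b_r b_ok]|/hasPn no_b] :=
  boolP (has (fun b => 0 <= (m - x) * (b - m)) r).
  by exists b.
(* Otherwise this sum, which equals (m - x)^2, would be negative. *)
have : \sum_(b <- r) (m - x) * (b - m) < 0.
  case: r r_neq0 no_b {sum_r} => // y r _ no_b.
  rewrite big_cons -[ltRHS]addr0; apply: ltr_leD.
    by rewrite ltNge no_b ?mem_head.
  rewrite big_seq; apply: sumr_le0 => b b_r.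
  by rewrite ltW // ltNge no_b // inE b_r orbT.
rewrite -mulr_sumr sumrB big_const_seq count_predT iter_addr_0 -mulr_natl.
have -> : \sum_(y <- r) y - (size r)%:R * m = m - x.
  by move: sum_r; rewrite -natr1; lra.
by rewrite ltNge -expr2 sqr_ge0.
Qed.

(** Smoothing: replacing two entries [x] and [b] on opposite sides of the mean
    [m] by [m] and [x + b - m] keeps their sum and adds (m - x) (b - m) X^2 to
    the product of their factors. *)
Lemma coef_prod_le_mean (R : realFieldType) (m : R) (xs : seq R) :
  0 <= m -> {in xs, forall x, 0 <= x} -> \sum_(x <- xs) x = (size xs)%:R * m ->
  forall k, (\prod_(x <- xs) (1 + x *: 'X))`_k <= ((1 + m *: 'X) ^+ size xs)`_k.
Proof.
move=> m_ge0.
(* The factor P collects the entries that are already equal to m. *)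
suff main (P : {poly R}) : (forall k, 0 <= P`_k) -> {in xs, forall x, 0 <= x} ->
    \sum_(x <- xs) x = (size xs)%:R * m ->
    forall k, (P * \prod_(x <- xs) (1 + x *: 'X))`_k
              <= (P * (1 + m *: 'X) ^+ size xs)`_k.
  move=> xs0 sum_xs k; have := main 1; rewrite !mul1r; apply=> // l.
  by rewrite coef1 ler0n.
have lin_ge0 (x : R) k : 0 <= x -> 0 <= (1 + x *: 'X)`_k.
  by move=> x0; rewrite coefD coef1 coefZ coefX addr_ge0 ?mulr_ge0 ?ler0n.
have [n] := ubnP (size xs).
elim: n xs P => // n IHn [|x r] P /= size_xs P0 xs0 sum_xs k.
  by rewrite big_nil.
have x0 : 0 <= x by rewrite xs0 ?mem_head.
have [r_nil|r_neq0] := eqVneq r [::].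
  by move: sum_xs; rewrite r_nil !big_seq1 mul1r expr1 => ->.
rewrite big_cons in sum_xs.
have [b b_r b_ok] := exists_opposite_side r_neq0 sum_xs.
have b0 : 0 <= b by rewrite xs0 // inE b_r orbT.
have xb_ge0 : 0 <= x + b - m.
  have [x_lt|x_ge] := ltP x m; last by lra.
  have : 0 <= b - m by rewrite -(pmulr_rge0 _ (_ : 0 < m - x)) // subr_gt0.
  by lra.
have perm_r := perm_to_rem b_r.
have size_r : size r = (size (rem b r)).+1 by rewrite (perm_size perm_r).
rewrite (perm_big _ perm_r) /= big_cons in sum_xs.
rewrite big_cons (perm_big _ perm_r) /= big_cons.
set Q := \prod_(y <- rem b r) _.
have Q0 l : 0 <= Q`_l.
  have -> : Q = \prod_(y <- rem b r) ((1 : R)%:P + y *: 'X) by [].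
  by apply: coef_prod_linear_ge0 => // y /mem_rem y_r; rewrite xs0 // inE y_r orbT.
have := IHn ((x + b - m) :: rem b r) (P * (1 + m *: 'X)).
rewrite /= -size_r big_cons -/Q => IH.
have {}IH : (P * (1 + m *: 'X) * ((1 + (x + b - m) *: 'X) * Q))`_k
    <= (P * (1 + m *: 'X) * (1 + m *: 'X) ^+ size r)`_k.
  have := IH size_xs _ _ _ k; rewrite big_cons -/Q; apply.
  - by apply: coef_mul_ge0 => // l; exact: lin_ge0.
  - move=> y; rewrite inE => /orP[/eqP ->//|/mem_rem y_r].
    by rewrite xs0 // inE y_r orbT.
  - by move: sum_xs; rewrite -natr1; lra.
rewrite exprS [in leRHS]mulrA; apply: le_trans IH.
rewrite -subr_ge0 -coefB (_ : _ - _ = P * (((m - x) * (b - m)) *: 'X^2) * Q).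
  apply: coef_mul_ge0 => //; apply: coef_mul_ge0 => // l.
  by rewrite coefZ coefXn mulr_ge0 ?ler0n.
rewrite -!mul_polyC !rmorphM !rmorphB !rmorphD /=; ring.
Qed.

Lemma esym_le_mean (R : realFieldType) d k (x : 'I_d -> R) (m : R) :
  0 <= m -> (forall i, 0 <= x i) -> \sum_i x i = d%:R * m ->
  \sum_(S : {set 'I_d} | #|S| == k) \prod_(i in S) x i <= 'C(d, k)%:R * m ^+ k.
Proof.
move=> m0 x0 sum_x; have := @coef_prod_le_mean R m [seq x i | i <- index_enum 'I_d] m0.
have size_d : size [seq x i | i <- index_enum 'I_d] = d.
  by rewrite size_map -[RHS]card_ord cardT enumT.
rewrite size_d !big_map sum_x => /(_ _ erefl k) H.
have {H} := H (fun _ => _); rewrite -/(is_true _).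
have E (y : 'I_d -> R) : (\prod_i (1 + y i *: 'X))`_k =
    \sum_(S : {set 'I_d} | #|S| == k) \prod_(i in S) y i.
  rewrite -[LHS]/((\prod_i ((1 : R)%:P + y i *: 'X))`_k) (coef_prod_linear (fun=> 1)).
  by apply: eq_bigr => S _; rewrite -big_mkcond.
have -> : (1 + m *: 'X) ^+ d = \prod_(i < d) (1 + m *: 'X).
  by rewrite prodr_const card_ord.
rewrite !E => H; apply: le_trans (H _) _; first by move=> _ /mapP[i _ ->].
rewrite (eq_bigr (fun=> m ^+ k)) => [|S /eqP <-]; last by rewrite prodr_const.
by rewrite sumr_const -cardsE card_draws card_ord mulr_natl.
Qed.

(** * The spectrum bound *)

Lemma mxsub_mulmx (R : pzRingType) m n (f : 'I_m -> 'I_n) (A : 'M[R]_n) :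
  mxsub f f A = rowsub f 1%:M *m A *m (rowsub f 1%:M)^T.
Proof.
rewrite mul_rowsub_mx mul1mx trmx_mxsub trmx1 mulmx_colsub mulmx1.
by apply/matrixP => i j; rewrite !mxE.
Qed.

Lemma psdmx_pminor_inv (R : realType) n (G : 'M[R]_n) (S : {set 'I_n}) :
  psdmx G -> G \in unitmx -> 1 <= pminor G S * pminor (invmx G) S.
Proof.
move=> G_psd G_unit; rewrite /pminor !mxsub_mulmx.
apply: psdmx_det_compress_inv => //.
rewrite -[X in X *m _]mulmx1 -mxsub_mulmx; apply/matrixP => i j.
by rewrite !mxE (inj_eq enum_val_inj).
Qed.

Lemma psdmx_pminor_ge0 (R : realType) n (G : 'M[R]_n) (S : {set 'I_n}) :
  psdmx G -> 0 <= pminor G S.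
Proof.
by move=> G_psd; rewrite /pminor mxsub_mulmx psdmx_det_ge0 //; exact: psdmx_congr.
Qed.

Lemma cauchy_schwarz_sum (R : realFieldType) (I : Type) (r : seq I) (P : pred I)
    (a b c : I -> R) :
  (forall i, P i -> [/\ 0 <= a i, 0 <= b i, 0 <= c i & a i ^+ 2 <= b i * c i]) ->
  (\sum_(i <- r | P i) a i) ^+ 2
    <= (\sum_(i <- r | P i) b i) * \sum_(i <- r | P i) c i.
Proof.
move=> abc.
suff: [/\ 0 <= \sum_(i <- r | P i) a i, 0 <= \sum_(i <- r | P i) b i,
    0 <= \sum_(i <- r | P i) c i & (\sum_(i <- r | P i) a i) ^+ 2
    <= (\sum_(i <- r | P i) b i) * \sum_(i <- r | P i) c i] by case.
elim/big_ind3: _ => // c1 b1 a1 c2 b2 a2.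
move=> [a1_ge0 b1_ge0 c1_ge0 h1] [a2_ge0 b2_ge0 c2_ge0 h2].
split; rewrite ?addr_ge0 //.
have cross : 2 * (a1 * a2) <= b1 * c2 + b2 * c1.
  have sum_ge0 : 0 <= b1 * c2 + b2 * c1 by rewrite addr_ge0 ?mulr_ge0.
  rewrite -ler_sqr ?nnegrE ?mulr_ge0 //.
  have : (a1 * a2) ^+ 2 <= b1 * c1 * (b2 * c2).
    by rewrite exprMn ler_pM ?sqr_ge0.
  have := sqr_ge0 (b1 * c2 - b2 * c1).
  by rewrite sqrrB sqrrD !exprMn; lra.
by move: cross h1 h2; rewrite sqrrD mulrDl !mulrDr; lra.
Qed.

Lemma diag_mx_unit (R : fieldType) n (w : 'rV[R]_n) :
  (forall i, w 0 i != 0) -> diag_mx w \in unitmx.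
Proof.
by move=> w_neq0; rewrite unitmxE unitfE det_diag; apply/prodf_neq0 => i _.
Qed.

Lemma esym_inv (R : fieldType) d k (y : 'I_d -> R) :
  (forall i, y i != 0) -> (k <= d)%N ->
  \prod_i y i * \sum_(S : {set 'I_d} | #|S| == k) \prod_(i in S) (y i)^-1
    = \sum_(S : {set 'I_d} | #|S| == (d - k)%N) \prod_(i in S) y i.
Proof.
move=> y0 kd; rewrite mulr_sumr [RHS](reindex_inj (@finset.setC_inj _)) /=.
apply: eq_big => [S|S _].
  have := cardsC S; rewrite card_ord => cS.
  by move: #|S| #|~: S| cS kd => u v <- ukv; apply/eqP/eqP => ?; lia.
rewrite (bigID (mem S)) /= mulrAC -big_split /= big1 ?mul1r => [|i _].
  by apply: eq_bigl => i; rewrite inE.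
by rewrite mulfV.
Qed.

(** In an orthonormal eigenbasis of [N], with [Q] the diagonal square root of
    [N], the matrix G^-1 N has the same minor sums as Q G^-1 Q, whose principal
    minor on [S] is the square of the product over [S] of the square roots of
    the eigenvalues, times that of G^-1.  So each term of the left-hand sum,
    once squared, is at most the product of the minors of [G] and of Q G^-1 Q
    on [S]. *)
Lemma esym_sqrt_spectrum_le (R : realType) n s (G N V : 'M[R]_n) (l : 'rV[R]_n) :
  psdmx G -> G \in unitmx -> V *m V^T = 1%:M -> V *m N *m V^T = diag_mx l ->
  (forall i, 0 < l 0 i) ->
  (\sum_(S : {set 'I_n} | #|S| == s) \prod_(i in S) Num.sqrt (l 0 i)) ^+ 2
    <= sum_pminors s G * sum_pminors s (invmx G *m N).
Proof.
move=> G_psd G_unit VV VNV l_gt0.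
have VTV := mulmx1C VV; have [V_unit VT_unit] := mulmx1_unit VV.
pose K := V *m (G *m V^T); pose Ki := V *m (invmx G *m V^T).
have K_psd : psdmx K by rewrite /K mulmxA; exact: psdmx_congr.
have K_Ki : K *m Ki = 1%:M.
  rewrite /K /Ki !mulmxA -[_ *m V^T *m V]mulmxA VTV mulmx1.
  by rewrite -[_ *m G *m _]mulmxA mulmxV // mulmx1.
have [K_unit _] := mulmx1_unit K_Ki.
have K_inv : invmx K = Ki by rewrite -[RHS](mulKmx K_unit) K_Ki mulmx1.
have Ki_psd : psdmx (invmx K).
  have := psdmx_congr (invmx K) K_psd.
  by rewrite mulVmx // mul1mx trmx_inv K_psd.1.
pose Q := diag_mx (map_mx Num.sqrt l).
have Q_unit : Q \in unitmx.
  by apply: diag_mx_unit => i; rewrite mxE gt_eqF // sqrtr_gt0.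
have QQ : Q *m Q = V *m N *m V^T.
  rewrite VNV mulmx_diag; congr diag_mx; apply/rowP => i.
  by rewrite !mxE -expr2 sqr_sqrtr // ltW.
have pminor_Q S : pminor (Q *m (invmx K *m Q)) S
    = (\prod_(i in S) Num.sqrt (l 0 i)) ^+ 2 * pminor (invmx K) S.
  rewrite pminor_diagM pminor_mul_diag mulrCA mulrC -expr2.
  by congr (_ ^+ 2 * _); apply: eq_bigr => i _; rewrite mxE.
have -> : sum_pminors s G = sum_pminors s K.
  by rewrite /K sum_pminorsC // -mulmxA VTV mulmx1.
have -> : sum_pminors s (invmx G *m N) = sum_pminors s (Q *m (invmx K *m Q)).
  rewrite [RHS]sum_pminorsC // -mulmxA QQ K_inv.
  have -> : Ki *m (V *m N *m V^T) = V *m (invmx G *m N *m V^T).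
    by rewrite /Ki !mulmxA -[_ *m V^T *m V]mulmxA VTV mulmx1.
  by rewrite [RHS]sum_pminorsC // -[_ *m V^T *m V]mulmxA VTV mulmx1.
apply: cauchy_schwarz_sum => S _; split.
- by rewrite prodr_ge0 // => i _; rewrite sqrtr_ge0.
- exact: psdmx_pminor_ge0.
- by rewrite pminor_Q mulr_ge0 ?sqr_ge0 // psdmx_pminor_ge0.
- rewrite pminor_Q mulrCA ler_peMr ?sqr_ge0 //; exact: psdmx_pminor_inv.
Qed.

Lemma psdmx_spectral_gt0 (R : realType) n (N V : 'M[R]_n) (l : 'rV[R]_n) i :
  psdmx N -> N \in unitmx -> V *m V^T = 1%:M -> V *m N *m V^T = diag_mx l ->
  0 < l 0 i.
Proof.
move=> N_psd N_unit VV VNV; have [V_unit VT_unit] := mulmx1_unit VV.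
have := psdmx_congr V N_psd; rewrite VNV => -[_ /(_ (delta_mx i 0))].
rewrite trmx_delta -rowE -colE !mxE eqxx mulr1n => l_ge0.
have : \det (diag_mx l) != 0.
  by rewrite -unitfE -unitmxE -VNV unitmx_mul VT_unit unitmx_mul V_unit N_unit.
by rewrite det_diag lt0r l_ge0 => /prodf_neq0/(_ i isT) ->.
Qed.

(** * Bounding the determinant of the linx matrix *)

Lemma linx_det_le_interior (R : realType) d s (C : 'M[R]_d) (x : 'rV[R]_d) (M : R) :
  psdmx C -> C \in unitmx -> (forall i, 0 < x 0 i < 1) -> (0 < s < d)%N ->
  (forall S : {set 'I_d}, #|S| = s -> pminor C S <= M) ->
  exists2 g : R, 0 < g & \det (linx_mx C g x) <= g ^+ s * (M ^+ 2 *
    ((\sum_(S : {set 'I_d} | #|S| == s) \prod_(i in S) x 0 i) *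
     \sum_(S : {set 'I_d} | #|S| == (d - s)%N) \prod_(i in S) (1 - x 0 i))).
Proof.
move=> C_psd C_unit x01 s_bounds C_le.
have x_gt0 i : 0 < x 0 i by have /andP[] := x01 i.
pose y i := 1 - x 0 i.
have y_gt0 i : 0 < y i by rewrite subr_gt0; have /andP[] := x01 i.
pose D := diag_mx x.
pose rt : 'rV[R]_d := \row_i Num.sqrt (y i).
have rt_sqr i : rt 0 i ^+ 2 = y i by rewrite mxE sqr_sqrtr // ltW.
have rt_neq0 i : rt 0 i != 0 by rewrite mxE gt_eqF // sqrtr_gt0.
pose B := diag_mx rt; pose A := diag_mx (map_mx GRing.inv rt).
have AB : A *m B = 1%:M.
  rewrite mulmx_diag -diag_const_mx; congr diag_mx; apply/rowP => i.
  by rewrite [LHS]mxE [RHS]mxE [X in X * _]mxE mulVf.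
have BA : B *m A = 1%:M by exact: mulmx1C.
have A_tr : A^T = A by exact: tr_diag_mx.
have C_tr : C^T = C := C_psd.1.
have [A_unit _] := mulmx1_unit AB.
have D_unit : D \in unitmx by apply: diag_mx_unit => i; rewrite gt_eqF.
have D_psd : psdmx D by apply: psdmx_diag => i; rewrite ltW.
pose N := A *m C *m D *m C *m A.
have N_psd : psdmx N.
  by have := psdmx_congr (A *m C) D_psd; rewrite trmx_mul C_tr A_tr !mulmxA.
have N_unit : N \in unitmx by rewrite !unitmx_mul A_unit C_unit D_unit.
have [V [l [VV VNV _]]] := psdmx_spectral N_psd.
have l_gt0 i : 0 < l 0 i by exact: psdmx_spectral_gt0 N_psd N_unit VV VNV.
pose c i := Num.sqrt (l 0 i).
have c_gt0 i : 0 < c i by rewrite sqrtr_gt0.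
have [h h_gt0 prod_le] := exists_scale_prod_le c_gt0 s_bounds.
have det_linx g : \det (linx_mx C g x) = \prod_i y i * \det (1%:M + g *: N).
  have -> : linx_mx C g x = B *m (1%:M + g *: N) *m B.
    rewrite mulmxDr mulmxDl mulmx1 -scalemxAr -scalemxAl /N !mulmxA BA mul1mx.
    rewrite -[C *m D *m C *m A *m B]mulmxA AB mulmx1.
    rewrite /linx_mx -addrA addrC; congr (_ + _).
    rewrite mulmx_diag -diag_const_mx -linearB /=; congr diag_mx; apply/rowP => i.
    by rewrite [RHS]mxE -expr2 rt_sqr !mxE.
  rewrite !det_mulmx mulrAC -expr2 det_diag -prodrXl.
  by congr (_ * _); apply: eq_bigr => i _.
exists (h ^+ 2); first by rewrite exprn_gt0.
rewrite det_linx (orthomx_det1D _ VV VNV).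
have -> : \prod_i (1 + h ^+ 2 * l 0 i) = \prod_i (1 + (h * c i) ^+ 2).
  by apply: eq_bigr => i _; rewrite exprMn sqr_sqrtr // ltW.
have y_prod_ge0 : 0 <= \prod_i y i by rewrite prodr_ge0 // => i _; rewrite ltW.
apply: le_trans (ler_wpM2l y_prod_ge0 prod_le) _.
rewrite exprMn exprAC mulrCA ler_wpM2l ?exprn_ge0 ?(ltW h_gt0) //.
pose G := A *m C *m A.
have G_psd : psdmx G.
  by have := psdmx_congr A C_psd; rewrite A_tr.
have G_unit : G \in unitmx by rewrite !unitmx_mul A_unit C_unit.
have E_le := esym_sqrt_spectrum_le s G_psd G_unit VV VNV l_gt0.
have GN : sum_pminors s (invmx G *m N) = sum_pminors s (D *m C).
  have -> : invmx G *m N = B *m (D *m C *m A).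
    have -> : N = G *m (B *m (D *m C *m A)).
      by rewrite /N /G !mulmxA -[_ *m A *m B]mulmxA AB mulmx1.
    by rewrite mulKmx.
  rewrite sum_pminorsC ?(mulmx1_unit AB).2 //.
  by rewrite -[_ *m A *m B]mulmxA AB mulmx1.
have pminor_G S : pminor G S = \prod_(i in S) (y i)^-1 * pminor C S.
  rewrite pminor_mul_diag pminor_diagM mulrAC; congr (_ * _).
  rewrite -big_split /=; apply: eq_bigr => i _.
  by rewrite mxE -invfM -expr2 rt_sqr.
have G_le : sum_pminors s G <=
    M * \sum_(S : {set 'I_d} | #|S| == s) \prod_(i in S) (y i)^-1.
  rewrite mulr_sumr; apply: ler_sum => S /eqP S_s; rewrite pminor_G mulrC.
  rewrite ler_wpM2r ?C_le // prodr_ge0 // => i _; by rewrite invr_ge0 ltW.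
have DC_le : sum_pminors s (D *m C) <=
    M * \sum_(S : {set 'I_d} | #|S| == s) \prod_(i in S) x 0 i.
  rewrite mulr_sumr; apply: ler_sum => S /eqP S_s; rewrite pminor_diagM mulrC.
  by rewrite ler_wpM2r ?C_le // prodr_ge0 // => i _; rewrite ltW.
have G_ge0 : 0 <= sum_pminors s G.
  by apply: sumr_ge0 => S _; exact: psdmx_pminor_ge0.
have DC_ge0 : 0 <= sum_pminors s (D *m C).
  apply: sumr_ge0 => S _; rewrite pminor_diagM mulr_ge0 ?psdmx_pminor_ge0 //.
  by rewrite prodr_ge0 // => i _; rewrite ltW.
rewrite GN in E_le.
have {E_le} := le_trans E_le (ler_pM G_ge0 DC_ge0 G_le DC_le).
move=> /(ler_wpM2l y_prod_ge0) E_le; apply: le_trans E_le _.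
have s_le : (s <= d)%N by case/andP: s_bounds => _ /ltnW.
have y_neq0 i : y i != 0 by rewrite gt_eqF.
rewrite -[X in _ <= _ * (_ * X)](esym_inv y_neq0 s_le) le_eqVlt.
by apply/orP; left; apply/eqP; ring.
Qed.

Lemma psdmx_linx (R : realType) d (C : 'M[R]_d) (g : R) (x : 'rV[R]_d) :
  psdmx C -> 0 <= g -> (forall i, 0 <= x 0 i <= 1) -> psdmx (linx_mx C g x).
Proof.
move=> C_psd g0 x01.
have -> : linx_mx C g x = C *m diag_mx (g *: x) *m C^T + diag_mx (const_mx 1 - x).
  rewrite /linx_mx C_psd.1 -addrA; congr (_ + _).
    by rewrite linearZ /= -scalemxAr -scalemxAl.
  by rewrite linearB /= diag_const_mx.
by apply: psdmxD; [apply: psdmx_congr|]; apply: psdmx_diag => i;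
  have /andP[? ?] := x01 i; rewrite !mxE ?mulr_ge0 ?subr_ge0.
Qed.

(** The point [w = t x + (1 - t) (s/d, ..., s/d)] is interior, and its linx
    matrix is at least [t] times that of [x]; the factor [t ^+ d] is the price
    for the determinant. *)
Lemma linx_det_le (R : realType) d s (C : 'M[R]_d) (x : 'rV[R]_d) (M t : R) :
  psdmx C -> C \in unitmx -> cardinality_polytope R d s x -> (0 < s < d)%N ->
  (forall S : {set 'I_d}, #|S| = s -> pminor C S <= M) -> 0 < t < 1 ->
  exists2 g : R, 0 < g & t ^+ d * \det (linx_mx C g x) <= g ^+ s * (M ^+ 2 *
    (('C(d, s)%:R * (s%:R / d%:R) ^+ s) *
     ('C(d, s)%:R * ((d - s)%:R / d%:R) ^+ (d - s)))).
Proof.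
move=> C_psd C_unit [x01 sum_x] s_bounds C_le /andP[t0 t1].
have /andP[s_gt0 s_lt] := s_bounds.
have d_gt0 : 0 < d%:R :> R by rewrite ltr0n (leq_trans _ s_lt).
have d_neq0 : d%:R != 0 :> R by rewrite gt_eqF.
pose m : R := s%:R / d%:R.
have m_gt0 : 0 < m by rewrite divr_gt0 // ltr0n.
have m_lt1 : m < 1 by rewrite ltr_pdivrMr // mul1r ltr_nat.
have m_compl : (d - s)%:R / d%:R = 1 - m :> R.
  by rewrite natrB ?(ltnW s_lt) // mulrBl divff.
pose z : 'rV[R]_d := const_mx m.
pose w : 'rV[R]_d := t *: x + (1 - t) *: z.
have w_eq i : w 0 i = t * x 0 i + (1 - t) * m by rewrite !mxE.
have w01 i : 0 < w 0 i < 1.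
  have /andP[xi0 xi1] := x01 i; rewrite w_eq.
  have h1 : 0 <= t * x 0 i by rewrite mulr_ge0 // ltW.
  have h2 : 0 < (1 - t) * m by rewrite mulr_gt0 // subr_gt0.
  have h3 : t * x 0 i <= t by rewrite ler_piMr // ltW.
  have h4 : (1 - t) * m < 1 - t by rewrite gtr_pMr // subr_gt0.
  by apply/andP; split; lra.
have sum_w : \sum_i w 0 i = d%:R * m.
  under eq_bigr do rewrite w_eq.
  rewrite big_split /= -mulr_sumr sum_x sumr_const card_ord -mulr_natl /m.
  by field.
have sum_w' : \sum_i (1 - w 0 i) = d%:R * (1 - m).
  by rewrite sumrB sum_w sumr_const card_ord mulrBr mulr1.
have [g g_gt0 det_w] := linx_det_le_interior C_psd C_unit w01 s_bounds C_le.
exists g => //.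
have z01 i : 0 <= z 0 i <= 1 by rewrite !mxE !ltW.
have linx_w : linx_mx C g w = t *: linx_mx C g x + (1 - t) *: linx_mx C g z.
  rewrite /linx_mx /w linearD !linearZ /= mulmxDr mulmxDl -!scalemxAr -!scalemxAl.
  move: (diag_mx x) (diag_mx z) (C *m diag_mx x *m C) (C *m diag_mx z *m C).
  by move=> ? ? ? ?; apply/matrixP => i j; rewrite !mxE; ring.
have : \det (t *: linx_mx C g x) <= \det (linx_mx C g w).
  rewrite linx_w; apply: psdmx_det_le; apply: psdmxZ; rewrite ?subr_ge0 ?ltW //;
    by apply: psdmx_linx => //; exact: ltW.
rewrite detZ => /le_trans; apply; apply: le_trans det_w _.
rewrite ler_wpM2l ?exprn_ge0 ?(ltW g_gt0) // ler_wpM2l ?sqr_ge0 //.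
have w_ge0 i : 0 <= w 0 i by have /andP[/ltW] := w01 i.
have w_le1 i : 0 <= 1 - w 0 i by have /andP[_ /ltW] := w01 i; rewrite subr_ge0.
apply: ler_pM.
- by apply: sumr_ge0 => S _; apply: prodr_ge0.
- by apply: sumr_ge0 => S _; apply: prodr_ge0.
- exact: (esym_le_mean s (ltW m_gt0) w_ge0 sum_w).
rewrite m_compl -[in leRHS](bin_sub (ltnW s_lt)).
by apply: esym_le_mean => //; rewrite subr_ge0 ltW.
Qed.

(** * The integrality gap *)

Lemma exists_max_pminor (R : realType) d s (C : 'M[R]_d) : (s <= d)%N ->
  exists2 S : {set 'I_d}, #|S| = s &
    forall S' : {set 'I_d}, #|S'| = s -> pminor C S' <= pminor C S.
Proof.
move=> s_le; have /card_gt0P[S0] : (0 < #|[set S : {set 'I_d} | #|S| == s]%SET|)%N.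
  by rewrite card_draws card_ord bin_gt0.
rewrite inE => S0_s.
have [S /eqP S_s S_max] :=
  @arg_maxP _ R _ S0 (fun S : {set 'I_d} => #|S| == s) (pminor C) S0_s.
by exists S => // S' /eqP /S_max.
Qed.

Lemma psdmx_pminor_gt0 (R : realType) n (G : 'M[R]_n) (S : {set 'I_n}) :
  psdmx G -> G \in unitmx -> 0 < pminor G S.
Proof.
move=> G_psd G_unit; rewrite lt0r psdmx_pminor_ge0 // andbT.
apply: contraTneq (psdmx_pminor_inv S G_psd G_unit) => ->.
by rewrite mul0r ler10.
Qed.

(** The factor expR (- (2 * e / d)) ^+ d = expR (- 2 e) becomes the loss [e]
    after taking minus one half of the logarithm. *)
Lemma linx_obj_ge (R : realType) d s (C : 'M[R]_d) (g Q e : R) (x : 'rV[R]_d) :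
  (0 < d)%N -> 0 < g -> 0 < Q ->
  expR (- (2 * e / d%:R)) ^+ d * \det (linx_mx C g x) <= g ^+ s * Q ->
  ((- 2^-1 * ln Q - e)%:E <= linx_obj C s g x)%E.
Proof.
move=> d_gt0 g_gt0 Q_gt0 det_le; rewrite /linx_obj /logdet.
(* lne is -oo on nonpositive arguments, and then the objective is +oo. *)
have [det_le0|det_gt0] := leP (\det (linx_mx C g x)) 0.
  rewrite le0_lneNy ?lee_fin // -EFinN mulrNy ltr0_sg ?oppr_lt0 ?invr_gt0 //.
  by rewrite EFinN mulN1e leey.
rewrite lne_EFin // -EFinN -EFinM -EFinD lee_fin.
have : ln (expR (- (2 * e / d%:R)) ^+ d * \det (linx_mx C g x)) <= ln (g ^+ s * Q).
  by rewrite ler_ln ?posrE ?mulr_gt0 ?exprn_gt0 ?expR_gt0.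
rewrite !lnM ?posrE ?exprn_gt0 ?expR_gt0 // !lnXn ?expR_gt0 // expRK.
rewrite -[ln g *+ s]mulr_natl -[_ *+ d]mulr_natl mulrN.
rewrite [d%:R * _]mulrC divfK ?gt_eqF ?ltr0n //.
by lra.
Qed.

Theorem corollary4 (R : realType) (d s : nat) (C : 'M[R]_d) (X : set 'rV[R]_d)
    (C_psd : psdmx C) (C_full_rank : \rank C = d)
    (s_bounds : (1 <= s <= d - 1)%N)
    (X_def : X = cardinality_polytope R d s) :
  (Opt C s
     - (2^-1 * (s%:R * ln s%:R + (d - s)%:R * ln (d - s)%:R
                - d%:R * ln d%:R))%:E
     - (ln ('C(d, s))%:R)%:E
   <= Opt_linx_o C s X)%E.
Proof.
have s_lt_d : (0 < s < d)%N by move: s_bounds; clear; case: d => [|d']; lia.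
have [s_gt0 s_lt] := andP s_lt_d.
have d_gt0 : (0 < d)%N by exact: leq_trans s_lt.
have C_unit : C \in unitmx by rewrite -row_full_unit /row_full C_full_rank.
have [S S_s S_max] := exists_max_pminor C (ltnW s_lt).
have M_gt0 : 0 < pminor C S by exact: psdmx_pminor_gt0.
have ds_gt0 : 0 < (d - s)%:R :> R by rewrite ltr0n subn_gt0.
have dR_gt0 : 0 < d%:R :> R by rewrite ltr0n.
have sR_gt0 : 0 < s%:R :> R by rewrite ltr0n.
have bin_gt0R : 0 < 'C(d, s)%:R :> R by rewrite ltr0n bin_gt0 ltnW.
pose Q := pminor C S ^+ 2 *
    (('C(d, s)%:R * (s%:R / d%:R) ^+ s) *
     ('C(d, s)%:R * ((d - s)%:R / d%:R) ^+ (d - s))).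
have Q_gt0 : 0 < Q by rewrite !mulr_gt0 ?exprn_gt0 ?divr_gt0.
have ln_Q : - 2^-1 * ln Q = - ln (pminor C S)
    - 2^-1 * (s%:R * ln s%:R + (d - s)%:R * ln (d - s)%:R - d%:R * ln d%:R)
    - ln 'C(d, s)%:R.
  have ln_prod (p b u v : R) : 0 < p -> 0 < b -> 0 < u -> 0 < v ->
      ln (p ^+ 2 * ((b * u ^+ s) * (b * v ^+ (d - s))))
        = 2 * ln p + (ln b + s%:R * ln u + (ln b + (d - s)%:R * ln v)).
    move=> p_gt0 b_gt0 u_gt0 v_gt0.
    have bu_gt0 : 0 < b * u ^+ s by rewrite mulr_gt0 ?exprn_gt0.
    have bv_gt0 : 0 < b * v ^+ (d - s) by rewrite mulr_gt0 ?exprn_gt0.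
    rewrite lnM ?posrE ?exprn_gt0 ?(mulr_gt0 bu_gt0) // lnXn // lnM ?posrE //.
    rewrite lnM ?posrE ?exprn_gt0 // lnXn // lnM ?posrE ?exprn_gt0 // lnXn //.
    by rewrite !mulr_natl.
  rewrite /Q ln_prod ?divr_gt0 // !ln_div ?posrE //.
  by rewrite (natrB _ (ltnW s_lt)); lra.
have Opt_le : (Opt C s <= (- ln (pminor C S))%:E)%E.
  rewrite EFinN -lne_EFin //; apply: ereal_inf_lbound.
  by exists S.
apply: le_trans (_ : (- 2^-1 * ln Q)%:E <= _)%E.
  by rewrite ln_Q !EFinB; apply: leeB => //; exact: leeB.
apply: le_ereal_inf_tmp => _ [x x_X <-]; rewrite X_def in x_X.
apply/lee_subgt0Pr => e e_gt0.
have t01 : 0 < expR (- (2 * e / d%:R) : R) < 1.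
  by rewrite expR_gt0 expR_lt1 oppr_lt0 divr_gt0 ?mulr_gt0.
have [g g_gt0 det_le] := linx_det_le C_psd C_unit x_X s_lt_d S_max t01.
apply: le_trans (linx_obj_ge d_gt0 g_gt0 Q_gt0 det_le) _.
by apply: ereal_sup_ubound; exists g.
Qed.
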